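(* Every extensional congruence is a lambda congruence.
   Context: Let $\mathbb{V}$ be an infinite set whose elements are called variables. The set $\mathbb{T}$ of terms is the set of words inductively defined by: every variable $x$ is a term; if $A,B$ are terms then $[AB]$ is a term; if $x$ is a variable and $A$ a term then $[\lambda x A]$ is a term. Equality of terms is syntactic identity. We abbreviate $[AB]$ as $AB$ and $[\lambda x A]$ as $\lambda x A$. A binary relation $\sim$ on $\mathbb{T}$ is a congruence if it is reflexive, symmetric, transitive, and for all terms $A,B,C,D$ and every variable $x$: $A\sim B$ implies $\lambda x A \sim \lambda x B$, and $A\sim B$, $C \sim D$ imply $AC \sim BD$. A prelambda congruence is a congruence $\sim$ such that for all terms $A,B,D$ and all variables $x,y$: ($\beta_1$) $[\lambda x x]D \sim D$; ($\beta_2$) $[\lambda x y]D \sim y$ whenever $x\neq y$; ($\beta_3$) $[\lambda x[AB]]D \sim [[\lambda x A]D][[\lambda x B]D]$; ($\beta_4$) $[\lambda x[\lambda x A]]D \sim \lambda x A$; ($\beta_5$) if $x \neq y$ and $[\lambda y D]x \sim D$, then $[\lambda x[\lambda y A]]D \sim \lambda y[[\lambda x A]D]$. A lambda congruence is a prelambda congruence $\sim$ satisfying ($\alpha_e$): for every term $A$ and all variables $x,y$, if $[\lambda y A]x \sim A$ then $\lambda x A \sim \lambda y[[\lambda x A]y]$. An extensional congruence is a prelambda congruence $\sim$ satisfying ($\eta_e$): $y \sim \lambda x[yx]$ for all variables $x, y$ with $x \neq y$. *)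

(* Defs.v *)
From Stdlib Require Export Relations RelationClasses FinFun.

(* Terms are taken as a datatype, and `=` on them is syntactic identity: by
   unique readability of the fully bracketed words [AB] and [\x A], these trees
   are in bijection with those words.  Bound variables are named, and terms are
   not identified up to renaming. *)
Inductive term (V : Type) : Type :=
| Var : V -> term V
| App : term V -> term V -> term V
| Lam : V -> term V -> term V.

Arguments Var {V} x.
Arguments App {V} A B.
Arguments Lam {V} x A.

Section Congruences.

Context {V : Type}.
Implicit Types (x y : V) (A B C D : term V).

Record congruence (R : relation (term V)) : Prop := {
  congruence_equiv :: Equivalence R;
  congruence_lam : forall A B x, R A B -> R (Lam x A) (Lam x B);
  congruence_app : forall A B C D, R A B -> R C D -> R (App A C) (App B D)
}.

Record prelambda_congruence (R : relation (term V)) : Prop := {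
  prelambda_is_congruence : congruence R;
  beta1 : forall D x, R (App (Lam x (Var x)) D) D;
  beta2 : forall D x y, x <> y -> R (App (Lam x (Var y)) D) (Var y);
  beta3 : forall A B D x,
    R (App (Lam x (App A B)) D) (App (App (Lam x A) D) (App (Lam x B) D));
  beta4 : forall A D x, R (App (Lam x (Lam x A)) D) (Lam x A);
  beta5 : forall A D x y, x <> y ->
    R (App (Lam y D) (Var x)) D ->
    R (App (Lam x (Lam y A)) D) (Lam y (App (Lam x A) D))
}.

Record lambda_congruence (R : relation (term V)) : Prop := {
  lambda_is_prelambda : prelambda_congruence R;
  alpha_e : forall A x y,
    R (App (Lam y A) (Var x)) A ->
    R (Lam x A) (Lam y (App (Lam x A) (Var y)))
}.

Record extensional_congruence (R : relation (term V)) : Prop := {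
  extensional_is_prelambda : prelambda_congruence R;
  eta_e : forall x y, x <> y -> R (Var y) (Lam x (App (Var y) (Var x)))
}.

End Congruences.

(* Main.v *)
Require Import Defs.
From Stdlib Require Import Relations RelationClasses FinFun.
From Stdlib Require Import Classical List.
Import ListNotations.

(** If [(\y A) x ~ A] for one variable [x] other than [y], then [(\y A) D ~ A]
    for every [D]: replace [A] under the binder by [(\y A) x], in which [y] is
    inert.  Choosing for [D] a variable [z] other than [x] and [y], (beta_5) then
    gives [(\y \x A) z ~ \x A], so [M = \x A] may be substituted for [z] in the
    axiom [z ~ \y (z y)], which yields [M ~ \y (M y)].  When [x = y] there is
    nothing to extend: [(\x A) x ~ A] holds in every prelambda congruence. *)

Lemma not_finite_avoid2 (V : Type) (x y : V) :
  ~ Finite V -> exists z, z <> x /\ z <> y.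
Proof.
  intros V_infinite; apply NNPP; intros no_z.
  apply V_infinite; exists [x; y]; intros z.
  destruct (classic (x = z)) as [xz | xz]; [now left |].
  destruct (classic (y = z)) as [yz | yz]; [now right; left |].
  exfalso; apply no_z; exists z; split; congruence.
Qed.

Section Prelambda.

Context {V : Type} {R : relation (term V)} (HR : prelambda_congruence R).

Let HC : congruence R := prelambda_is_congruence R HR.

#[local] Instance prelambda_equivalence : Equivalence R :=
  congruence_equiv R HC.

(** Induction on [A]. Under a binder [y] other than [x], (beta_5) with [Var x] as argument asks for
    (\y x) x ~ x, an instance of (beta_2). *)
Lemma app_lam_self (x : V) (A : term V) : R (App (Lam x A) (Var x)) A.
Proof.
  induction A as [y | A IHA B IHB | y A IHA].
  - destruct (classic (x = y)) as [<- | xy].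
    + exact (beta1 R HR _ _).
    + exact (beta2 R HR _ _ _ xy).
  - etransitivity; [exact (beta3 R HR _ _ _ _) |].
    exact (congruence_app R HC _ _ _ _ IHA IHB).
  - destruct (classic (x = y)) as [<- | xy].
    + exact (beta4 R HR _ _ _).
    + etransitivity; [| exact (congruence_lam R HC _ _ y IHA)].
      apply (beta5 R HR); [exact xy |].
      apply (beta2 R HR); congruence.
Qed.

Lemma app_lam_inert (x y : V) (A D : term V) :
  y <> x -> R (App (Lam y A) (Var x)) A -> R (App (Lam y A) D) A.
Proof.
  intros yx HA.
  transitivity (App (Lam y (App (Lam y A) (Var x))) D).
  { apply (congruence_app R HC); [| reflexivity].
    apply (congruence_lam R HC); now symmetry. }
  etransitivity; [exact (beta3 R HR _ _ _ _) |].
  etransitivity; [| exact HA].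
  apply (congruence_app R HC);
    [exact (beta4 R HR _ _ _) | exact (beta2 R HR _ _ _ yx)].
Qed.

(** The argument is a variable so that the side condition of (beta_5) becomes (\x z) y ~ z, an
    instance of (beta_2); for an arbitrary term it need not hold. *)
Lemma app_lam_lam_inert (x y z : V) (A : term V) :
  y <> x -> x <> z -> R (App (Lam y A) (Var z)) A ->
  R (App (Lam y (Lam x A)) (Var z)) (Lam x A).
Proof.
  intros yx xz HA.
  etransitivity; [| exact (congruence_lam R HC _ _ x HA)].
  apply (beta5 R HR); [exact yx | exact (beta2 R HR _ _ _ xz)].
Qed.

End Prelambda.

Lemma eta_of_inert (V : Type) (R : relation (term V)) (y z : V) (M : term V) :
  extensional_congruence R -> z <> y -> R (App (Lam y M) (Var z)) M ->
  R M (Lam y (App M (Var y))).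
Proof.
  intros [HR eta] zy HM.
  pose proof (prelambda_is_congruence R HR) as HC.
  pose proof (congruence_equiv R HC) as HE.
  (* A redex simulates substitution: in (\z z) M the body [z] is a variable, to which (eta_e)
     applies. *)
  transitivity (App (Lam z (Var z)) M); [symmetry; exact (beta1 R HR _ _) |].
  transitivity (App (Lam z (Lam y (App (Var z) (Var y)))) M).
  { apply (congruence_app R HC); [| reflexivity].
    apply (congruence_lam R HC), eta; congruence. }
  (* [HM] is exactly the side condition for moving [M] under \y. *)
  etransitivity; [exact (beta5 R HR _ _ _ _ zy HM) |].
  apply (congruence_lam R HC).
  etransitivity; [exact (beta3 R HR _ _ _ _) |].
  apply (congruence_app R HC);
    [exact (beta1 R HR _ _) | exact (beta2 R HR _ _ _ zy)].
Qed.

Theorem theorem6p3 (V : Type) (V_infinite : ~ Finite V)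
    (R : relation (term V)) :
  extensional_congruence R -> lambda_congruence R.
Proof.
  intros HX.
  pose proof (extensional_is_prelambda R HX) as HR.
  pose proof (prelambda_is_congruence R HR) as HC.
  pose proof (congruence_equiv R HC) as HE.
  split; [exact HR |]; intros A x y HA.
  destruct (classic (y = x)) as [-> | yx].
  - apply (congruence_lam R HC); symmetry; exact (app_lam_self HR x A).
  (* [z] must differ from [x] to pass under \x, and from [y] for (eta_e) and (beta_5). *)
  - destruct (not_finite_avoid2 V x y V_infinite) as [z [zx zy]].
    apply (eta_of_inert V R y z); trivial.
    apply (app_lam_lam_inert HR); [exact yx | congruence |].
    exact (app_lam_inert HR x y A (Var z) yx HA).
Qed.
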